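(* Let $G$ be a distinguished group, let $A=\{a_1,\dots,a_v\}$ be a simple subgroup of $G$ of order $v$, let $p,q\in G$ and $H_{pq}=(A.p).(A.q)$. Let $\tau_1=p.q,\tau_2,\dots,\tau_v\in G$ be elements with $H_{pq}=\bigcup_{i=1}^v A.\tau_i$, where the $A.\tau_i$ are pairwise disjoint if $H_{pq}$ has $v^2$ elements. If for some $k,l\in\{1,\dots,v\}$ $$A.\tau_k=(A.p).(a_l.q),$$ then $H_{pq}$ has order $v$; and conversely, if $H_{pq}$ has order $v$, then this relation holds for some $k$ and $l$.
   Context: A distributive group is a nonempty set $G$ with a binary operation $(a,b)\mapsto a.b$ on $G$ such that for all $a,b\in G$ each of the equations $a.x=b$ and $y.a=b$ has exactly one solution in $G$, and for all $a,b,c\in G$, $(a.b).c=(a.c).(b.c)$ and $c.(a.b)=(c.a).(c.b)$. A subgroup of $G$ is a nonempty subset which is itself a distributive group under the restricted operation; the order is the number of elements. A distributive group is simple if it has no proper subgroup of order greater than one. For subsets $X,Y\subseteq G$ and $p\in G$: $X.Y=\{x.y: x\in X,\,y\in Y\}$, $X.p=\{x.p: x\in X\}$, $p.X=\{p.x:x\in X\}$. A finite distributive group $G$ is called distinguished if for every subgroup $B$ of $G$ and every $p\in G$, the sets $B.(B.p)$ and $(B.p).B$ are subgroups of the same order as $B$; equivalently there are $t,\tau\in G$ with $B.(B.p)=B.t$ and $(B.p).B=B.(p.B)=B.\tau$. In this setting the set $H_{pq}$ has $v$ or $v^2$ elements, is a subgroup of $G$, and elements $\tau_i$ as described always exist.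 *)

(* Defs.v *)
From mathcomp Require Import all_boot.

Set Implicit Arguments.
Unset Strict Implicit.
Unset Printing Implicit Defensive.

Section DistributiveGroups.

Variables (G : finType) (op : G -> G -> G).

Implicit Types (A B X Y : {set G}) (p : G).

(* [B], with the restriction of [op], is a distributive group. *)
Record distributive_on B : Prop := DistributiveOn {
  don_neq0 : B != set0;
  don_closed : forall a b, a \in B -> b \in B -> op a b \in B;
  don_solr : forall a b, a \in B -> b \in B ->
    exists! x, x \in B /\ op a x = b;
  don_soll : forall a b, a \in B -> b \in B ->
    exists! y, y \in B /\ op y a = b;
  don_distl : forall a b c, a \in B -> b \in B -> c \in B ->
    op (op a b) c = op (op a c) (op b c);
  don_distr : forall a b c, a \in B -> b \in B -> c \in B ->
    op c (op a b) = op (op c a) (op c b)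
}.

Definition distributive_group : Prop := distributive_on [set: G].

Definition subgroup_of A B : Prop := B \subset A /\ distributive_on B.

(* A one-element distributive group counts as simple. *)
Definition simple_group A : Prop :=
  distributive_on A /\
  ~ (exists B, [/\ subgroup_of A B, B \proper A & 1 < #|B|]).

Definition set_op X Y : {set G} := [set op x y | x in X, y in Y].

Definition set_opr X p : {set G} := [set op x p | x in X].

Definition distinguished : Prop :=
  distributive_group /\
  forall B p, subgroup_of [set: G] B ->
    let L := set_op B (set_opr B p) in
    let R := set_op (set_opr B p) B in
    [/\ subgroup_of [set: G] L, #|L| = #|B|,
        subgroup_of [set: G] R & #|R| = #|B|].

End DistributiveGroups.

(* Main.v *)
Require Import Defs.
From mathcomp Require Import all_boot.

(** Call the sets [A.x] the cosets of a subgroup [A].  In a distinguished group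
they partition [G].  Indeed [b.(A.x)] and [A.(b.x)], for [b] in [A], both lie
in [A.(A.x)] and have as many elements as [A], which is the order of
[A.(A.x)]; so all three sets coincide.  If [A.x] and [A.y] share a point
[z = b.x = c.y], then [b.(A.x) = A.z = b.(A.y)], and cancelling [b] gives
[A.x = A.y] ([coset_eq]).  The translation by [p] is an automorphism of [G], so
the sets [(A.p).y] form a partition too ([translate_coset_eq]).

The theorem compares these two partitions.  The point [a.(p.q)] is also
[(a.p).(a.q)], so it lies both in [A.(p.q)] and in [(A.p).(a.q)].  If
[A.tau_k = (A.p).(a_l.q)], this set contains [a_l.(p.q)], hence it is the
coset [A.(p.q)].  So it contains every [a.(p.q)], that is, it meets every
[(A.p).(a.q)]; all of these are therefore equal, and so is their union [H].
Conversely, when [H] has order [v], the sets [A.(p.q)] and [(A.p).(a.q)] are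
both subsets of [H] with [v] elements. *)

Set Implicit Arguments.
Unset Strict Implicit.
Unset Printing Implicit Defensive.

Section Cosets.

Variables (G : finType) (op : G -> G -> G).

Implicit Types (A X Y : {set G}) (p q x y z : G).

Section DistributiveGroup.

Hypothesis dG : distributive_group op.

Lemma op_injr p : injective (op p).
Proof.
move=> x y exy.
have [z [_ Uz]] := don_solr dG (in_setT p) (in_setT (op p y)).
by rewrite -(Uz x) ?in_setT // -(Uz y) ?in_setT.
Qed.

Lemma op_injl p : injective (op^~ p).
Proof.
move=> x y exy.
have [z [_ Uz]] := don_soll dG (in_setT p) (in_setT (op y p)).
by rewrite -(Uz x) ?in_setT // -(Uz y) ?in_setT.
Qed.

Lemma op_surjl p y : exists x, y = op x p.
Proof.
by have [x [[_ <-] _]] := don_soll dG (in_setT p) (in_setT y); exists x.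
Qed.

Lemma op_distl x y z : op (op x y) z = op (op x z) (op y z).
Proof. exact: (don_distl dG). Qed.

Lemma op_distr x y z : op z (op x y) = op (op z x) (op z y).
Proof. exact: (don_distr dG). Qed.

Lemma card_set_opr X p : #|set_opr op X p| = #|X|.
Proof. exact/card_imset/op_injl. Qed.

Lemma set_opr_translate X p x :
  set_opr op (set_opr op X p) (op x p) = set_opr op (set_opr op X x) p.
Proof.
rewrite /set_opr -!imset_comp; apply: eq_imset => y /=.
by rewrite -op_distl.
Qed.

End DistributiveGroup.

Lemma set_opr_subset X Y y : y \in Y -> set_opr op X y \subset set_op op X Y.
Proof. by move=> Yy; apply/subsetP=> _ /imsetP[x Xx ->]; apply: imset2_f. Qed.

Section Distinguished.

Hypothesis hG : distinguished op.

Variable A : {set G}.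

Hypothesis sA : subgroup_of op [set: G] A.

Let dG : distributive_group op := hG.1.

Lemma card_set_op_coset x : #|set_op op A (set_opr op A x)| = #|A|.
Proof. by have [] := hG.2 A x sA. Qed.

Lemma coset_translate b x :
  b \in A -> set_opr op A (op b x) = set_op op A (set_opr op A x).
Proof.
move=> Ab; apply/eqP; rewrite eqEcard set_opr_subset ?imset_f //=.
by rewrite card_set_op_coset card_set_opr.
Qed.

Lemma translate_coset b x :
  b \in A -> op b @: set_opr op A x = set_op op A (set_opr op A x).
Proof.
move=> Ab; apply/eqP; rewrite eqEcard card_set_op_coset.
rewrite (card_imset _ (op_injr dG (p := b))) card_set_opr // leqnn andbT.
by apply/subsetP=> _ /imsetP[y Ay ->]; apply: imset2_f.
Qed.

(** Distinct cosets are disjoint because a common point [b.x = c.y] makes the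
translates of both cosets by one and the same [b] equal. *)
Lemma coset_eq x y z :
  z \in set_opr op A x -> z \in set_opr op A y ->
  set_opr op A x = set_opr op A y.
Proof.
case/imsetP=> b Ab -> /imsetP[c Ac ebc].
apply: (imset_inj (op_injr dG (p := b))).
by rewrite !translate_coset // -(coset_translate x Ab) ebc coset_translate.
Qed.

(** The translate [A.p] has disjoint cosets as well: since every [y] is some
[x.p], its cosets are the images under the automorphism [t |-> t.p] of those
of [A]. *)
Lemma translate_coset_eq p x y z :
  z \in set_opr op (set_opr op A p) x -> z \in set_opr op (set_opr op A p) y ->
  set_opr op (set_opr op A p) x = set_opr op (set_opr op A p) y.
Proof.
have [x' ->] := op_surjl dG p x; have [y' ->] := op_surjl dG p y.
rewrite !set_opr_translate // => /imsetP[t At ->] /imsetP[u Au].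
move/(op_injl dG) => etu; rewrite -etu in Au.
by rewrite (coset_eq At Au).
Qed.

End Distinguished.

End Cosets.

Theorem theorem5p8 (G : finType) (op : G -> G -> G)
    (hG : distinguished op)
    (v : nat) (hv : 0 < v) (a : 'I_v -> G) (ha : injective a)
    (A : {set G}) (hA : A = [set a i | i : 'I_v])
    (hAsub : subgroup_of op [set: G] A) (hAsimple : simple_group op A)
    (p q : G) (H : {set G})
    (hH : H = set_op op (set_opr op A p) (set_opr op A q))
    (tau : 'I_v -> G) (htau1 : tau (Ordinal hv) = op p q)
    (hcover : H = \bigcup_(i < v) set_opr op A (tau i))
    (hdisj : #|H| = v ^ 2 -> forall i j : 'I_v, i != j ->
       [disjoint set_opr op A (tau i) & set_opr op A (tau j)]) :
  (exists k l : 'I_v,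
     set_opr op A (tau k) = set_opr op (set_opr op A p) (op (a l) q))
  <-> #|H| = v.
Proof.
have [dG _] := hG; set B := set_opr op A p.
have cA : #|A| = v by rewrite hA card_imset ?card_ord.
have cB x : #|set_opr op B x| = v by rewrite !card_set_opr.
have Aa i : a i \in A by rewrite hA imset_f.
have Apq i : op (a i) (op p q) \in set_opr op A (op p q) by apply: imset_f.
have Bpq i : op (a i) (op p q) \in set_opr op B (op (a i) q).
  by rewrite op_distr // imset_f // imset_f.
have sBH i : set_opr op B (op (a i) q) \subset H.
  by rewrite hH set_opr_subset ?imset_f.
split=> [[k [l Ekl]] | cH]; last first.
  exists (Ordinal hv), (Ordinal hv); rewrite htau1 -/B.
  (* Both sides are subsets of [H] with as many elements as [H]. *)
  transitivity H; last by apply/esym/eqP; rewrite eqEcard sBH cB cH /=.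
  apply/eqP; rewrite eqEcard card_set_opr // cA cH leqnn andbT.
  by rewrite hcover -htau1 (bigcup_max (Ordinal hv)).
have Epq : set_opr op A (op p q) = set_opr op B (op (a l) q).
  by rewrite -Ekl; apply: (coset_eq hG hAsub (Apq l)); rewrite Ekl.
have EB i : set_opr op B (op (a i) q) = set_opr op B (op (a l) q).
  by apply: (translate_coset_eq hG hAsub (Bpq i)); rewrite -/B -Epq.
suff -> : H = set_opr op B (op (a l) q) by [].
apply/eqP; rewrite eqEsubset sBH andbT hH.
apply/subsetP=> _ /imset2P[x _ Bx /imsetP[b Ab ->] ->].
move: Ab; rewrite hA => /imsetP[i _ ->].
by rewrite -(EB i) imset_f.
Qed.
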